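(* Let $\mu$ be a measure on $\mathbb{R}^n$. If $\theta\in S^{n-1}$, then $$\overline{\dim}_{\mathrm{loc}}(\mu,x)=\limsup_{r\downarrow 0}\frac{\log\mu\bigl(B(x,r)\setminus H(x,\theta)\bigr)}{\log r},\qquad \underline{\dim}_{\mathrm{loc}}(\mu,x)=\liminf_{r\downarrow 0}\frac{\log\mu\bigl(B(x,r)\setminus H(x,\theta)\bigr)}{\log r}$$ for $\mu$-almost all $x\in\mathbb{R}^n$. Moreover, if $0<\alpha\le 1$, then $$\overline{\dim}_{\mathrm{loc}}(\mu,x)=\limsup_{r\downarrow 0}\sup_{\theta\in S^{n-1}}\frac{\log\mu\bigl(B(x,r)\setminus H(x,\theta,\alpha)\bigr)}{\log r},\qquad \underline{\dim}_{\mathrm{loc}}(\mu,x)=\liminf_{r\downarrow 0}\sup_{\theta\in S^{n-1}}\frac{\log\mu\bigl(B(x,r)\setminus H(x,\theta,\alpha)\bigr)}{\log r}$$ for $\mu$-almost all $x\in\mathbb{R}^n$.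
   Context: A measure on $\mathbb{R}^n$ ($n\in\mathbb{N}$, $n\ge 1$) means a nontrivial Borel regular outer measure defined on all subsets of $\mathbb{R}^n$ such that bounded sets have finite measure. $B(x,r)$ is the closed ball with centre $x$ and radius $r>0$, and $S^{n-1}$ is the unit sphere of $\mathbb{R}^n$. For $x\in\mathbb{R}^n$, $\theta\in S^{n-1}$ and $0\le\alpha\le 1$, $H(x,\theta,\alpha)=\{y\in\mathbb{R}^n:(y-x)\cdot\theta>\alpha|y-x|\}$, and $H(x,\theta)=H(x,\theta,0)$. The upper and lower local dimensions of $\mu$ at $x$ are $\overline{\dim}_{\mathrm{loc}}(\mu,x)=\limsup_{r\downarrow 0}\frac{\log\mu(B(x,r))}{\log r}$ and $\underline{\dim}_{\mathrm{loc}}(\mu,x)=\liminf_{r\downarrow 0}\frac{\log\mu(B(x,r))}{\log r}$. Convention: $\log 0=-\infty$, so $\log 0/\log r=+\infty$ for $0<r<1$. *)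

(* Defs.v *)
From HB Require Import structures.
From mathcomp Require Import all_boot all_order all_algebra.
From mathcomp Require Import all_classical all_reals all_analysis.

Set Implicit Arguments.
Unset Strict Implicit.
Unset Printing Implicit Defensive.

Import Order.TTheory GRing.Theory Num.Theory.
Import numFieldNormedType.Exports.

Local Open Scope classical_set_scope.
Local Open Scope ring_scope.

Section euclidean.
Context {R : realType} {n : nat}.
Implicit Types (x y u v theta : 'rV[R]_n) (r alpha : R).

Definition dot u v : R := \sum_(i < n) u ord0 i * v ord0 i.

(* The canonical norm of 'rV[R]_n is the sup norm, hence a separate Euclidean
   norm; both induce the same topology and the same bounded sets. *)
Definition enorm v : R := Num.sqrt (dot v v).

Definition eball x r : set 'rV[R]_n := [set y | enorm (y - x) <= r].

Definition esphere : set 'rV[R]_n := [set theta | enorm theta = 1].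

Definition cone x theta alpha : set 'rV[R]_n :=
  [set y | alpha * enorm (y - x) < dot (y - x) theta].

Definition halfspace x theta : set 'rV[R]_n := cone x theta 0.

Definition borel : set (set 'rV[R]_n) := <<s open >>.

End euclidean.

Section measures.
Context {R : realType} {n : nat}.
Implicit Types (mu : set 'rV[R]_n -> \bar R) (A B : set 'rV[R]_n).

Definition borel_regular mu : Prop :=
  (forall B, borel B -> mu.-caratheodory B) /\
  (forall A, exists B, [/\ borel B, A `<=` B & mu B = mu A]).

(* Monotonicity and countable subadditivity come from the type of [mu]. *)
Definition is_measure (mu : {outer_measure set 'rV[R]_n -> \bar R}) : Prop :=
  [/\ mu setT != 0%E,
      borel_regular mu &
      forall A, bounded_set A -> (mu A < +oo)%E].

(* [mu] is defined on all subsets, so no measurable null superset of the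
   exceptional set has to be asked for. *)
Definition almost_all mu (P : 'rV[R]_n -> Prop) : Prop :=
  mu [set x | ~ P x] = 0%E.

(* Here [lne 0 = -oo]; for [0 < r < 1] the divisor is a negative real, so a
   null set [A] gives [+oo]. *)
Definition log_ratio mu A (r : R) : \bar R := (lne (mu A) / (ln r)%:E)%E.

Definition upper_local_dim mu (x : 'rV[R]_n) : \bar R :=
  limf_esup (fun r : R => log_ratio mu (eball x r) r) 0^'+.

Definition lower_local_dim mu (x : 'rV[R]_n) : \bar R :=
  limf_einf (fun r : R => log_ratio mu (eball x r) r) 0^'+.

End measures.

(* Main.v *)
Require Import Defs.
From HB Require Import structures.
From mathcomp Require Import all_boot all_order all_algebra.
From mathcomp Require Import all_classical all_reals all_analysis.
From mathcomp Require Import zify ring lra.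
Import Order.TTheory GRing.Theory Num.Theory.
Import numFieldNormedType.Exports.
Local Open Scope classical_set_scope.
Local Open Scope ring_scope.

(** Why the theorem is true.

Removing a half-space from a ball can only decrease its measure, hence only
increase the quotient of logarithms, so one inequality is immediate. For the
other one it is enough that, for every eta > 0 and almost every x, the half
ball at scale e^-k carries at least the fraction e^(-eta k) of a ball of
comparable radius about x, for all large k. A loss by such a factor, like the
passage to a comparable radius, disappears in the limit after taking
logarithms and dividing by log r.

The measure estimate behind this is a maximum principle. Cut space into cubes
of side s = e^-k / n, so that a cube has diameter at most e^-k, and let A be
the set of bad points at scale k. Take the part of A inside one cube Q and
look at its point x furthest in direction theta: all the rest of this part
lies in the closed half-space behind x, and within distance e^-k of x. Hence
mu(A & Q) is at most the measure of the half ball at x, which, x being bad,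
is less than e^(-eta k) times the measure of B(x, s), itself covered by the
3^n cubes that touch Q. If the maximum is not attained, x is replaced by a
maximizing sequence ([outer_measure_sublevels_le]). Summing over the cubes,
each of which is counted 3^n times, bounds the measure of the bad points of a
bounded region by a constant times e^(-eta k) ([deficient_measure_le]). These
bounds are summable, and the Borel-Cantelli lemma concludes
([almost_all_halfball_thick]).

For the uniform version with opening alpha > 0, cover the sphere by finitely
many sets of diameter comparable to alpha / n. A cone of opening alpha around
theta lies in the half-space of any direction close enough to theta
([cone_sub_halfspace]), so the statement for finitely many half-spaces
controls the supremum over all theta. *)

(** * Upper and lower limits as the radius tends to 0 *)

Lemma at_right0P {R : realType} (P : R -> Prop) :
  (\forall r \near 0^'+, P r) <->
  exists2 e : R, 0 < e & forall r, 0 < r < e -> P r.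
Proof.
split=> [|[e e0 H]].
  rewrite near_withinE /= => /nbhs_ballP[e /= e0 H].
  exists e => // r /andP[r0 re].
  by apply: H => //=; rewrite /ball /= sub0r normrN gtr0_norm.
near=> r; apply: H; apply/andP; split; near: r.
  exact: nbhs_right_gt.
exact: nbhs_right_lt.
Unshelve. all: by end_near. Qed.

Lemma at_right0_scale {R : realType} (K : R) (P : R -> Prop) : 0 < K ->
  (\forall r \near 0^'+, P r) -> \forall r \near 0^'+, P (K * r).
Proof.
move=> K0 /at_right0P[e e0 Pe]; apply/at_right0P.
exists (e / K); first by rewrite divr_gt0.
move=> r /andP[r0 re]; apply: Pe.
by rewrite mulr_gt0 //= mulrC -ltr_pdivlMr.
Qed.

Lemma ereal_lt_between {R : realType} (x y : \bar R) :
  (x < y)%E -> exists c : R, (x < c%:E < y)%E.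
Proof.
case: x y => [x||] [y||]; rewrite ?ltxx // ?[(+oo < _)%E]ltNge ?leey //
  ?[(_ < -oo)%E]ltNge ?leNye // => xy.
- exists ((x + y) / 2); rewrite !lte_fin.
  by move: xy; rewrite lte_fin => /midf_lt[-> ->].
- by exists (x + 1); rewrite lte_fin ltrDl ltr01 ltry.
- by exists (y - 1); rewrite lte_fin ltrBlDr ltrDl ltr01 ltNyr.
- by exists 0; rewrite ltNyr ltry.
Qed.

Lemma ereal_le_real_bounds {R : realType} (x y : \bar R) :
  (forall c : R, (y < c%:E)%E -> (x <= c%:E)%E) -> (x <= y)%E.
Proof.
move=> H; rewrite leNgt; apply/negP => /ereal_lt_between[c /andP[yc cx]].
by have := H _ yc; rewrite leNgt cx.
Qed.

Lemma limf_esup_le {R : realType} (f g : R -> \bar R) :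
  (\forall r \near 0^'+, (f r <= g r)%E) ->
  (limf_esup f 0^'+ <= limf_esup g 0^'+)%E.
Proof.
move=> fg; apply: le_ereal_inf_tmp => _ [V V0 <-].
apply: ge_ereal_inf.
exists (ereal_sup [set f r | r in V `&` [set r | (f r <= g r)%E]]).
  by exists (V `&` [set r | (f r <= g r)%E]) => //; exact: filterI.
apply: ge_ereal_sup => _ [r [Vr fgr] <-]; apply: le_trans fgr _.
by apply: ereal_sup_ubound; exists r.
Qed.

Lemma limf_einf_le {R : realType} (f g : R -> \bar R) :
  (\forall r \near 0^'+, (f r <= g r)%E) ->
  (limf_einf f 0^'+ <= limf_einf g 0^'+)%E.
Proof.
move=> fg; rewrite /limf_einf leeN2; apply: limf_esup_le.
by apply: filterS fg => r; rewrite leeN2.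
Qed.

(** The form in which the two limits are compared: a bound on f at radius s
yields an almost equally good bound on g at the comparable radius K s. Since
the implication holds at every small s separately, it serves the upper limit
(bounds for all small s) and the lower limit (bounds for arbitrarily small s)
alike. *)
Lemma limf_transfer {R : realType} (K : R) (f g : R -> \bar R) : 0 < K ->
  (\forall r \near 0^'+, (f r <= g r)%E) ->
  (forall c c' : R, c < c' ->
     \forall s \near 0^'+, (f s <= c%:E)%E -> (g (K * s)%R <= c'%:E)%E) ->
  limf_esup f 0^'+ = limf_esup g 0^'+ /\ limf_einf f 0^'+ = limf_einf g 0^'+.
Proof.
move=> K0 fg trans; split; apply/eqP; rewrite eq_le.
  rewrite limf_esup_le //=; apply: ereal_le_real_bounds => c'.
  move=> /ereal_lt_between[c /andP[fc]]; rewrite lte_fin => cc'.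
  have [_ [V V0 <-] /ltW Vc] := ereal_inf_lt fc.
  have gK : \forall s \near 0^'+, (g (K * s)%R <= c'%:E)%E.
    apply: filterS2 (trans _ _ cc') V0 => s + Vs; apply.
    by apply: le_trans Vc; apply: ereal_sup_ubound; exists s.
  have K'0 : 0 < K^-1 by rewrite invr_gt0.
  apply: ge_ereal_inf; eexists.
    by eexists; first exact: (at_right0_scale _ _ K'0 gK).
  by apply: ge_ereal_sup => _ [r /= + <-]; rewrite mulVKf // gt_eqF.
rewrite limf_einf_le //=; apply: ereal_le_real_bounds => c'.
move=> /ereal_lt_between[c /andP[fc]]; rewrite lte_fin => cc'.
rewrite limf_einfE; apply: ge_ereal_sup => _ [V V0 <-].
pose W s := ((f s <= c%:E)%E -> (g (K * s)%R <= c'%:E)%E) /\ V (K * s).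
have W0 : (0^'+ : set (set R)) W.
  exact: filterI (trans _ _ cc') (at_right0_scale _ V K0 V0).
have /ereal_inf_lt[_ [s [/= Hs Vs] <-] /ltW fsc] :
    (ereal_inf (f @` W) < c%:E)%E.
  apply: le_lt_trans fc; rewrite limf_einfE.
  by apply: ereal_sup_ubound; exists W.
by apply: ge_ereal_inf; exists (g (K * s)); [exists (K * s)|exact: Hs].
Qed.

Lemma log_ratio_monotone {R : realType} (u v : \bar R) (r : R) : 0 < r < 1 ->
  (0 <= u)%E -> (u <= v)%E -> (lne v / (ln r)%:E <= lne u / (ln r)%:E)%E.
Proof.
move=> r01 u0 uv; have lr : ln r < 0 by rewrite ln_lt0.
rewrite inver lt_eqF // leNgt lte_nmul2r // ?lte_fin ?invr_lt0 // -leNgt.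
by rewrite lee_lne // in_itv /= ?u0 ?(le_trans u0) //= leey.
Qed.

(** An upper bound on the quotient of logarithms is a lower bound on the
measure by a power of r, since log r < 0; this also covers the values 0 and
+oo of the measure. *)
Lemma log_ratio_leP {R : realType} (u : \bar R) (c r : R) :
  0 < r < 1 -> (0 <= u)%E ->
  (lne u / (ln r)%:E <= c%:E)%E = ((expR (c * ln r))%:E <= u)%E.
Proof.
move=> r01; have lr : ln r < 0 by rewrite ln_lt0.
rewrite inver lt_eqF //.
case: u => [u||] //= u0; last first.
  by rewrite leey mulyr ltr0_sg ?invr_lt0 // mulN1e leNye.
case: ifPn => [u0'|]; last first.
  rewrite -ltNge => u0'; rewrite -EFinM !lee_fin ler_ndivrMr //.
  by rewrite -[u in RHS]lnK ?posrE // ler_expR.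
rewrite mulNyr ltr0_sg ?invr_lt0 // mulN1e /= leye_eq /= lee_fin.
apply/esym/negbTE.
by rewrite -ltNge (le_lt_trans u0') // expR_gt0.
Qed.

(** With L = ln (K s) tending to -oo, the hypothesis costs eta (1 - L) in the
logarithm and the change of radius costs the constant c ln K; divided by L
these become eta + o(1), which is below c' - c for eta = (c' - c) / 2 and s
small. *)
Lemma log_ratio_transfer {R : realType} (K : R) (a b : R -> \bar R) : 1 <= K ->
  (forall r, 0 <= a r)%E -> (forall r, 0 <= b r)%E ->
  (forall eta : R, 0 < eta -> \forall s \near 0^'+,
      ((expR (- (eta * (1 - ln (K * s)))))%:E * a s <= b (K * s)%R)%E) ->
  forall c c' : R, c < c' -> \forall s \near 0^'+,
    (lne (a s) / (ln s)%:E <= c%:E)%E ->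
    (lne (b (K * s)%R) / (ln (K * s))%:E <= c'%:E)%E.
Proof.
move=> K1 a0 b0 H c c' cc'.
have K0 : 0 < K by exact: lt_le_trans K1.
pose eta := (c' - c) / 2.
have eta0 : 0 < eta by rewrite divr_gt0 // subr_gt0.
have /at_right0P[e e0 He] := H _ eta0.
(* K s < t means |c ln K| + eta < - eta ln (K s): this absorbs the constants. *)
pose t := expR (- (1 + `|c * ln K| / eta)).
apply/at_right0P; exists (Num.min e (t / K)).
  by rewrite lt_min e0 divr_gt0 // expR_gt0.
move=> s /andP[s0]; rewrite lt_min => /andP[se].
rewrite ltr_pdivlMr // mulrC => st.
have Ks0 : 0 < K * s by rewrite mulr_gt0.
have Lt : ln (K * s) < - (1 + `|c * ln K| / eta).
  by rewrite -[X in _ < X]expRK ltr_ln ?posrE ?expR_gt0.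
have L0 : ln (K * s) < 0.
  by apply: lt_le_trans Lt _; rewrite oppr_le0 addr_ge0 // divr_ge0 // ltW.
have Ks1 : K * s < 1 by rewrite -ltr_ln ?posrE ?ltr01 // ln1.
have s1 : s < 1 by apply: le_lt_trans Ks1; rewrite ler_peMl // ltW.
rewrite !log_ratio_leP ?s0 ?Ks0 // => cs.
apply: le_trans (He s _); last by rewrite s0.
apply: (@le_trans _ _ ((expR (- (eta * (1 - ln (K * s)))))%:E *
  (expR (c * ln s))%:E)%E); last first.
  by rewrite lee_wpmul2l // lee_fin expR_ge0.
rewrite -EFinM -expRD lee_fin ler_expR.
have -> : ln s = ln (K * s) - ln K by rewrite lnM ?posrE // addrC addKr.
set L := ln (K * s) in Lt L0 *.
have c'E : c' = c + 2 * eta by rewrite /eta; field.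
have : `|c * ln K| < - (1 + L) * eta by rewrite -ltr_pdivrMr //; lra.
have := ler_norm (c * ln K); rewrite c'E; nra.
Qed.

(** * Outer measures and measurable partitions *)

Lemma outer_measure_bigcup_null {R : realType} {T : Type}
    (mu : {outer_measure set T -> \bar R}) (F : nat -> set T) (A : set T) :
  A `<=` \bigcup_k F k -> (forall k, mu (F k) = 0%E) -> mu A = 0%E.
Proof.
move=> AF F0; apply/eqP; rewrite eq_le outer_measure_ge0 andbT.
apply: le_trans (le_outer_measure mu _ _ AF) _.
apply: le_trans (outer_measure_sigma_subadditive mu F) _.
by rewrite eseries0.
Qed.

(** If phi attains its supremum on A at x, then A itself is one of the sets of
the hypothesis. Otherwise A is the increasing union of the sets
A & {phi <= S - 1/(m+1)}, S being the supremum, each contained in a set of the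
hypothesis. Continuity from below along this union holds although A is
arbitrary, because the sublevel sets cut A measurably. *)
Lemma outer_measure_sublevels_le {R : realType} {T : Type}
    (mu : {outer_measure set T -> \bar R}) (phi : T -> R)
    (A : set T) (M : \bar R) :
  (0 <= M)%E -> (forall t, mu.-caratheodory [set x | phi x <= t]) ->
  has_ubound (phi @` A) ->
  (forall x, A x -> (mu (A `&` [set y | (phi y <= phi x)%R]) <= M)%E) ->
  (mu A <= M)%E.
Proof.
move=> M0 mphi ubA AM.
have [->|/set0P[a Aa]] := eqVneq A set0; first by rewrite outer_measure0.
have supA : has_sup (phi @` A) by split => //; exists (phi a); exists a.
set S := sup (phi @` A).
have leS x : A x -> phi x <= S.
  by move=> Ax; apply: sup_upper_bound => //; exists x.
have [[x Ax xS]|noS] := pselect (exists2 x, A x & phi x = S).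
  apply: le_trans (AM x Ax); apply: le_outer_measure => y Ay; split => //=.
  by rewrite xS leS.
pose C m := [set y | phi y <= S - m.+1%:R^-1].
have homoC : {homo C : m p / (m <= p)%N >-> (m <= p)%O}.
  move=> m p mp; apply/subsetPset => y /= /le_trans; apply.
  by rewrite lerD2l lerN2 lef_pV2 ?posrE ?ltr0n // ler_nat.
have AC m : (mu (A `&` C m) <= M)%E.
  have m0 : 0 < m.+1%:R^-1 :> R by rewrite invr_gt0.
  have [_ [x Ax <-] xS] := sup_adherent m0 supA.
  apply: le_trans (AM x Ax); apply: le_outer_measure => y [Ay /= yS].
  split => //=.
  by rewrite (le_trans yS) // ltW.
have mC m : mu.-caratheodory (C m) by exact: mphi.
have mD m : mu.-caratheodory (seqD C m).
  by case: m => [|m] //=; exact: caratheodory_measurable_setD.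
have tD : trivIset setT (seqD C) by exact: trivIset_seqD.
have AD : A `<=` \bigcup_m (A `&` seqD C m).
  rewrite -setI_bigcupr eq_bigcup_seqD => x Ax; split => //.
  have xS : 0 < S - phi x.
    rewrite subr_gt0 lt_neqAle leS // andbT.
    by apply/eqP => xS; apply: noS; exists x.
  have [m /= xm] := ltr_add_invr xS; exists m => //=.
  by move: xm; rewrite add0r => /ltW xm; rewrite /C /= lerBrDr -lerBrDl.
apply: le_trans (le_outer_measure mu _ _ AD) _.
apply: le_trans (outer_measure_sigma_subadditive mu _) _.
apply: lime_le.
  by apply: is_cvg_nneseries => *; exact: outer_measure_ge0.
apply: nearW => -[|m]; first by rewrite big_geq.
by rewrite big_mkord -caratheodory_additive // nondecreasing_bigsetU_seqD.
Qed.

Lemma sum_fibers_le {R : realType} {T : Type}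
    (mu : {outer_measure set T -> \bar R}) (h : T -> nat) (X : set T) :
  (forall k, mu.-caratheodory (h @^-1` [set k])) ->
  (\sum_(0 <= k <oo) mu (X `&` h @^-1` [set k]) <= mu X)%E.
Proof.
move=> mh; have th : trivIset setT (fun k => h @^-1` [set k]).
  apply/trivIsetP => i j _ _ ij; apply/seteqP; split => // x [/= hi hj].
  by move: ij; rewrite -hi -hj eqxx.
apply: le_trans (caratheodory_lime_le mh th X).
by rewrite leeDl // outer_measure_ge0.
Qed.

(** The counting step: the fibres of g are estimated by fibres of finitely
many maps h w. Each of these maps partitions X, so summing over all the fibres
counts X only #|W| times. *)
Lemma outer_measure_fibers_le {R : realType} {T : Type} {W : finType}
    (mu : {outer_measure set T -> \bar R}) (g : T -> nat) (h : W -> T -> nat)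
    (A X : set T) (q : R) :
  0 <= q -> (forall w k, mu.-caratheodory (h w @^-1` [set k])) ->
  (forall k, (mu (A `&` g @^-1` [set k]) <=
     q%:E * \sum_w mu (X `&` h w @^-1` [set k]))%E) ->
  (mu A <= q%:E * (#|W|%:R%:E * mu X))%E.
Proof.
move=> q0 mh Ak.
have AU : A `<=` \bigcup_k (A `&` g @^-1` [set k]) by move=> x Ax; exists (g x).
apply: le_trans (le_outer_measure mu _ _ AU) _.
apply: le_trans (outer_measure_sigma_subadditive mu _) _.
apply: le_trans (_ : (\sum_(0 <= k <oo)
    (q%:E * \sum_w mu (X `&` h w @^-1` [set k])) <= _)%E).
  by apply: lee_nneseries => [*|k _]; [exact: outer_measure_ge0|exact: Ak].
rewrite nneseriesZl => [|k _]; last first.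
  by apply: sume_ge0 => w _; exact: outer_measure_ge0.
rewrite lee_wpmul2l // nneseries_sum; last first.
  by move=> *; exact: outer_measure_ge0.
apply: le_trans (_ : (\sum_(w : W) mu X <= _)%E).
  by apply: lee_sum => w _; exact: sum_fibers_le.
by rewrite sumr_const mule_natl.
Qed.

Lemma outer_measure_Borel_Cantelli {R : realType} {T : Type}
    (mu : {outer_measure set T -> \bar R}) (A : nat -> set T) (C q : R) :
  0 <= C -> 0 < q < 1 -> (forall k, (mu (A k) <= (C * q ^+ k)%:E)%E) ->
  mu [set x | forall m, exists2 k, (m <= k)%N & A k x] = 0%E.
Proof.
move=> C0 /andP[q0 q1] AC; set L := [set x | _].
have q1' : 0 < 1 - q by rewrite subr_gt0.
have Lm m : (mu L <= (C * q ^+ m / (1 - q))%:E)%E.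
  have LU : L `<=` \bigcup_k A (k + m)%N.
    by move=> x /(_ m)[k mk Akx]; exists (k - m)%N => //; rewrite subnK.
  apply: le_trans (le_outer_measure mu _ _ LU) _.
  apply: le_trans (outer_measure_sigma_subadditive mu _) _.
  apply: lime_le.
    by apply: is_cvg_nneseries => *; exact: outer_measure_ge0.
  apply: nearW => N.
  apply: le_trans (_ : (\sum_(0 <= k < N) (C * q ^+ (k + m))%:E <= _)%E).
    by apply: lee_sum => k _; exact: AC.
  rewrite sumEFin lee_fin.
  apply: le_trans (geometric_le_lim N _ q0 _); last 2 first.
  - by rewrite mulr_ge0 // exprn_ge0 // ltW.
  - by rewrite gtr0_norm.
  rewrite /series /=; apply: ler_sum => k _.
  by rewrite exprD mulrAC mulrA.
apply/eqP; rewrite eq_le outer_measure_ge0 andbT.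
apply/lee_addgt0Pr => e e0; rewrite add0e.
have /cvgr0_norm_lt /(_ _ e0) : geometric (C / (1 - q)) q @ \oo --> 0.
  by apply: cvg_geometric; rewrite gtr0_norm.
move=> [m _ /(_ m (leqnn m)) /= Hm].
apply: le_trans (Lm m) _; rewrite lee_fin mulrAC.
by apply: le_trans (ltW Hm); exact: ler_norm.
Qed.

Lemma outer_measure_finite_cover {R : realType} {T : Type} {W : finType}
    (mu : {outer_measure set T -> \bar R}) (F : W -> set T) (A : set T) :
  (forall x, A x -> exists w, F w x) -> (mu A <= \sum_w mu (F w))%E.
Proof.
move=> AF.
have H s :
    (mu [set x | exists2 w, w \in s & F w x] <= \sum_(w <- s) mu (F w))%E.
  elim: s => [|w s IH].
    rewrite big_nil (_ : [set x | _] = set0) ?outer_measure0 //.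
    by apply/seteqP; split => // x [].
  rewrite big_cons; apply: le_trans (leeD2l _ IH).
  apply: le_trans (outer_measureU2 _ _ _); apply: le_outer_measure => x [v].
  by rewrite inE => /orP[/eqP->|vs] Fx; [left|right; exists v].
apply: le_trans (H _); apply: le_outer_measure => x /AF[w Fw].
by exists w => //; rewrite mem_index_enum.
Qed.

Lemma caratheodory_forall {R : realType} {T : Type} {I : finType}
    (mu : {outer_measure set T -> \bar R}) (P : I -> T -> Prop) :
  (forall i, mu.-caratheodory [set x | P i x]) ->
  mu.-caratheodory [set x | forall i, P i x].
Proof.
move=> mP.
have -> : [set x | forall i, P i x] = \big[setI/setT]_i [set x | P i x].
  rewrite -bigcap_seq; apply/seteqP; split => [x Px i _ //|x Px i].
  by apply: Px; rewrite /= mem_index_enum.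
elim/big_ind : _ => //; last exact: caratheodory_measurable_setI.
rewrite -setC0; apply: caratheodory_measurable_setC.
exact: caratheodory_measurable_set0.
Qed.

Lemma almost_all_forall {R : realType} {n : nat} {I : countType}
    (mu : {outer_measure set 'rV[R]_n -> \bar R}) (P : I -> 'rV[R]_n -> Prop) :
  (forall i, almost_all mu (P i)) -> almost_all mu (fun x => forall i, P i x).
Proof.
move=> P0; apply: (@outer_measure_bigcup_null _ _ mu
  (fun k => oapp (fun i => [set x | ~ P i x]) set0 (unpickle k))).
  by move=> x /existsNP[i Pi]; exists (pickle i) => //; rewrite pickleK.
by move=> k; case: unpickle => [i|]; [exact: P0|exact: outer_measure0].
Qed.

Lemma almost_all_mono {R : realType} {n : nat}
    (mu : {outer_measure set 'rV[R]_n -> \bar R}) (P Q : 'rV[R]_n -> Prop) :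
  (forall x, P x -> Q x) -> almost_all mu P -> almost_all mu Q.
Proof.
move=> PQ P0.
apply: (@outer_measure_bigcup_null _ _ mu (fun=> [set x | ~ P x])) => // x.
by move=> nQ; exists 0%N => // /PQ.
Qed.

(** * Euclidean geometry *)

Lemma enorm_ge0 {R : realType} {n : nat} (v : 'rV[R]_n) : 0 <= enorm v.
Proof. exact: sqrtr_ge0. Qed.

Lemma coord_le_enorm {R : realType} {n : nat} (v : 'rV[R]_n) i :
  `|v ord0 i| <= enorm v.
Proof.
rewrite -sqrtr_sqr /enorm ler_sqrt; last first.
  by apply: sumr_ge0 => j _; rewrite -expr2 sqr_ge0.
rewrite /dot (bigD1 i) //= expr2 lerDl sumr_ge0 // => j _.
by rewrite -expr2 sqr_ge0.
Qed.

Lemma enorm_le {R : realType} {n : nat} (v : 'rV[R]_n) s : 0 <= s ->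
  (forall i, `|v ord0 i| <= s) -> enorm v <= n%:R * s.
Proof.
move=> s0 vs; rewrite -[leRHS]ger0_norm ?mulr_ge0 //.
rewrite -sqrtr_sqr /enorm ler_wsqrtr //.
apply: (@le_trans _ _ (n%:R * s ^+ 2)).
  rewrite /dot mulr_natl -[n in leRHS]card_ord -sumr_const.
  apply: ler_sum => i _.
  by rewrite -expr2 -real_normK ?num_real // lerXn2r ?nnegrE.
rewrite exprMn ler_wpM2r ?sqr_ge0 // -natrX ler_nat.
by case: n {v vs} => // n; rewrite expnS expn1 leq_pmulr.
Qed.

Lemma dotBl {R : realType} {n : nat} (u v w : 'rV[R]_n) :
  dot (u - v) w = dot u w - dot v w.
Proof. by rewrite /dot -sumrB; apply: eq_bigr => i _; rewrite !mxE mulrBl. Qed.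

Lemma dotBr {R : realType} {n : nat} (u v w : 'rV[R]_n) :
  dot w (u - v) = dot w u - dot w v.
Proof. by rewrite /dot -sumrB; apply: eq_bigr => i _; rewrite !mxE mulrBr. Qed.

Lemma dot_le_coord {R : realType} {n : nat} (u v : 'rV[R]_n) s t :
  0 <= s ->
  (forall i, `|u ord0 i| <= s) -> (forall i, `|v ord0 i| <= t) ->
  dot u v <= n%:R * (s * t).
Proof.
move=> s0 us vt; rewrite /dot mulr_natl -[n in leRHS]card_ord -sumr_const.
by apply: ler_sum => i _; apply: le_trans (ler_norm _) _; rewrite normrM ler_pM.
Qed.

(** Replacing theta by theta' changes the inner product with y - x by at most
alpha |y - x|, which is exactly the margin that the cone provides. *)
Lemma cone_sub_halfspace {R : realType} {n : nat}
    (x theta theta' : 'rV[R]_n) (alpha : R) :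
  (forall i, `|(theta - theta') ord0 i| <= alpha / n%:R) ->
  cone x theta alpha `<=` halfspace x theta'.
Proof.
case: n x theta theta' => [|n] x theta theta' close y.
  by rewrite /halfspace /cone /= /enorm /dot !big_ord0 sqrtr0 !mulr0.
rewrite /halfspace /cone /= mul0r.
have := dot_le_coord _ _ _ _ (enorm_ge0 (y - x)) (coord_le_enorm _) close.
rewrite dotBr mulrCA (mulrC alpha) [X in _ * X]mulrA divff ?pnatr_eq0 //.
rewrite mul1r mulrC.
lra.
Qed.

Lemma eball_subset {R : realType} {n : nat} (x : 'rV[R]_n) r r' :
  r <= r' -> eball x r `<=` eball x r'.
Proof. by move=> rr' y /= /le_trans; apply. Qed.

Definition cube {R : realType} {n : nat} (N : R) : set 'rV[R]_n :=
  [set x | forall i, `|x ord0 i| <= N].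

Lemma bounded_cube {R : realType} {n : nat} (N : R) :
  bounded_set (cube N : set 'rV[R]_n).
Proof.
exists `|N|; split; first exact: num_real.
move=> M NM x xN; rewrite /= /Num.Def.normr /= mx_normrE.
apply: bigmax_le => [|[i j] _] /=; first exact: le_trans (ltW NM).
by rewrite ord1 (le_trans (xN j)) // (le_trans (ler_norm N)) // ltW.
Qed.

Lemma dot_continuous {R : realType} {n : nat} (theta : 'rV[R]_n) :
  continuous (fun x : 'rV[R]_n => dot x theta).
Proof.
move=> x; apply: (@cvg_big R _ +%R 0 predT _ _ (nbhs x)
    _ (fun i y => y ord0 i * theta ord0 i)) => [|i _].
  exact: add_continuous.
by apply: cvgM; [exact: coord_continuous|exact: cvg_cst].
Qed.

Lemma caratheodory_closed {R : realType} {n : nat}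
    (mu : {outer_measure set 'rV[R]_n -> \bar R}) (A : set 'rV[R]_n) :
  is_measure mu -> closed A -> mu.-caratheodory A.
Proof.
move=> [_ [borel_mu _] _] cA.
rewrite -[A]setCK; apply: caratheodory_measurable_setC.
by apply: borel_mu; apply: sub_sigma_algebra; exact: closed_openC.
Qed.

(** Rounding the coordinates down to multiples of d leaves finitely many
vectors, as the coordinates of unit vectors are at most 1 in absolute value. *)
Lemma finite_net_esphere {R : realType} {n : nat} (d : R) : 0 < d ->
  exists (W : finType) (net : W -> 'rV[R]_n), forall theta, esphere theta ->
    exists w, forall i, `|(theta - net w) ord0 i| <= d.
Proof.
move=> d0; have d'0 : 0 < d^-1 by rewrite invr_gt0.
(* M d > 1, so that the rounded quotients lie in [-M, M); adding M makes them
   indices. *)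
pose M := (Num.truncn d^-1).+1.
exists {ffun 'I_n -> 'I_(M + M)}.
exists (fun w : {ffun 'I_n -> 'I_(M + M)} => \row_i (((w i)%:R - M%:R) * d)).
move=> theta th.
exists [ffun i => inord (absz (Num.floor (theta ord0 i / d) + M))] => i.
rewrite !mxE ffunE.
have M1 : 1 < M%:R * d.
  rewrite -ltr_pdivrMr // div1r.
  by have /andP[] : _ := truncn_itv (ltW d'0).
have /andP[] : -1 <= theta ord0 i <= 1.
  by rewrite -ler_norml -th coord_le_enorm.
have /andP[] := floor_itv (theta ord0 i / d).
rewrite intrD ler_pdivlMr // ltr_pdivrMr //.
set f := Num.floor _ => f1 f2 t1 t2.
have Mf : (- M%:Z <= f)%R.
  rewrite -ltzD1 -(ltr_int R) intrD rmorphN /= -(ltr_pM2r d0) mulNr.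
  by apply: lt_trans f2; lra.
have fM : (f < M%:Z)%R.
  rewrite -(ltr_int R) -(ltr_pM2r d0).
  exact: le_lt_trans f1 (le_lt_trans t2 M1).
rewrite inordK; last first.
  by change (absz (f + M%:Z)%R < M + M)%N; lia.
have -> : (absz (f + M))%:R = f%:~R + M%:R :> R.
  by rewrite -[M%:R]/(M%:Z%:~R) -intrD [LHS]pmulrn; congr (1 *~ _); lia.
by rewrite addrK ler_norml; apply/andP; split; lra.
Qed.

(** * Grids of cubes *)

(** The cube of side s containing x, translated by -w and numbered by a
natural number. For fixed s and w the fibres are the cubes of the grid; the
shift w only changes their numbers, so that a cube and its neighbour w receive
the same number under shifts 0 and w. *)
Definition grid_cell {R : realType} {n : nat} (s : R) (w : {ffun 'I_n -> int})
    (x : 'rV[R]_n) : nat :=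
  pickle [ffun i => Num.floor (x ord0 i / s) - w i].

(** Indexed by a finite type, so that one can sum over the 3^n shifts. *)
Definition unit_shift {n : nat} (w : {ffun 'I_n -> 'I_3}) :
    {ffun 'I_n -> int} :=
  [ffun i => (w i)%:Z - 1].

Lemma grid_cell_floor {R : realType} {n : nat} (s : R) w (x y : 'rV[R]_n) i :
  grid_cell s w x = grid_cell s w y ->
  Num.floor (x ord0 i / s) = Num.floor (y ord0 i / s).
Proof.
move=> /(pcan_inj (@pickleK _)) /ffunP /(_ i).
by rewrite !ffunE => /addIr.
Qed.

Lemma grid_cell_diam {R : realType} {n : nat} (s : R) w (x y : 'rV[R]_n) :
  0 < s ->
  grid_cell s w x = grid_cell s w y -> enorm (y - x) <= n%:R * s.
Proof.
move=> s0 xy; apply: enorm_le => [|i]; first exact: ltW.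
have := grid_cell_floor _ _ _ _ i xy; rewrite !mxE.
have /andP[] := floor_itv (x ord0 i / s).
have /andP[] := floor_itv (y ord0 i / s).
move=> + + + + H; rewrite H !intrD !ler_pdivlMr // !ltr_pdivrMr // => *.
by rewrite ler_norml; apply/andP; split; lra.
Qed.

Lemma le_floor_add1 {R : realType} (u v : R) :
  u <= v + 1 -> Num.floor u <= Num.floor v + 1.
Proof.
move=> uv; have /andP[h1 _] := floor_itv u; have /andP[_ h2] := floor_itv v.
rewrite -ltzD1 -(ltr_int R) !intrD in h2 *; lra.
Qed.

Lemma grid_cell_neighbour {R : realType} {n : nat} (s : R) (x y : 'rV[R]_n) :
  0 < s ->
  enorm (y - x) <= s ->
  exists w, grid_cell s (unit_shift w) y = grid_cell s [ffun => 0] x.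
Proof.
move=> s0 yx.
have close i : (`|Num.floor (y ord0 i / s) - Num.floor (x ord0 i / s)| <= 1)%R.
  have : `|y ord0 i / s - x ord0 i / s| <= 1.
    rewrite -mulrBl normrM (gtr0_norm (x := s^-1)) ?invr_gt0 //.
    rewrite ler_pdivrMr // mul1r.
    by apply: le_trans yx; have := coord_le_enorm (y - x) i; rewrite !mxE.
  rewrite !ler_norml => /andP[h1 h2].
  have yx1 : Num.floor (y ord0 i / s) <= Num.floor (x ord0 i / s) + 1.
    by apply: le_floor_add1; lra.
  have xy1 : Num.floor (x ord0 i / s) <= Num.floor (y ord0 i / s) + 1.
    by apply: le_floor_add1; lra.
  by apply/andP; split; lia.
exists [ffun i => inord
  (absz (Num.floor (y ord0 i / s) - Num.floor (x ord0 i / s) + 1))].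
congr pickle; apply/ffunP => i; rewrite !ffunE subr0.
have := close i; set a := Num.floor _; set b := Num.floor _.
rewrite ler_norml => /andP[h1 h2].
rewrite inordK; first by rewrite gez0_abs; lia.
lia.
Qed.

Lemma caratheodory_grid_cell {R : realType} {n : nat} 
    (mu : {outer_measure set 'rV[R]_n -> \bar R}) (s : R) w k :
  is_measure mu -> 0 < s -> mu.-caratheodory (grid_cell s w @^-1` [set k]).
Proof.
move=> mu_meas s0.
have [[y yk]|noy] := pselect (exists y, grid_cell s w y = k); last first.
  rewrite (_ : _ @^-1` _ = set0); first exact: caratheodory_measurable_set0.
  by apply/seteqP; split => // x xk; apply: noy; exists x.
have -> : grid_cell s w @^-1` [set k] =
    [set x | forall i, Num.floor (x ord0 i / s) = Num.floor (y ord0 i / s)].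
  apply/seteqP; split => x /= xk => [i|].
    by apply: (grid_cell_floor _ w); rewrite xk.
  by rewrite -yk; congr pickle; apply/ffunP => i; rewrite !ffunE xk.
apply: caratheodory_forall => i; set z := Num.floor _.
have cc t : mu.-caratheodory [set x : 'rV[R]_n | t <= x ord0 i].
  apply: caratheodory_closed => //.
  apply: (@closed_comp _ _ (fun x : 'rV[R]_n => x ord0 i) [set u | t <= u]).
    by move=> *; exact: coord_continuous.
  exact: closed_ge.
have -> : [set x : 'rV[R]_n | Num.floor (x ord0 i / s) = z] =
    [set x : 'rV[R]_n | z%:~R * s <= x ord0 i] `\`
    [set x : 'rV[R]_n | (z + 1)%:~R * s <= x ord0 i].
  apply/seteqP; split => x /=.
    move=> <-; have /andP[h1 h2] := floor_itv (x ord0 i / s).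
    split; first by rewrite -ler_pdivlMr.
    by apply/negP; rewrite -ltNge -ltr_pdivrMr.
  move=> [h1 /negP]; rewrite -ltNge -ltr_pdivrMr // => h2.
  by apply: floor_def; rewrite h2 ler_pdivlMr // h1.
exact: caratheodory_measurable_setD.
Qed.

(** * Almost every half ball carries a large share of the measure *)

(** The maximum principle, with [cube (N + 1)] on the right because the balls
around the points of [cube N] stick out by at most s <= 1. *)
Lemma deficient_measure_le {R : realType} {n : nat}
    (mu : {outer_measure set 'rV[R]_n -> \bar R}) (theta : 'rV[R]_n)
    (N s q : R) :
  is_measure mu -> 0 < s <= 1 -> 0 <= q ->
  (mu ([set x | (mu (eball x (n%:R * s)%R `\` halfspace x theta) <
                   q%:E * mu (eball x s))%E] `&` cube N) <=
   q%:E * (#|{ffun 'I_n -> 'I_3}|%:R%:E * mu (cube (N + 1)%R)))%E.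
Proof.
move=> mu_meas /andP[s0 s1] q0; set A := [set x | _].
apply: (@outer_measure_fibers_le _ _ _ mu (grid_cell s [ffun=> 0])
  (fun w => grid_cell s (unit_shift w))) => //.
  by move=> w k; exact: caratheodory_grid_cell.
move=> k; apply: (@outer_measure_sublevels_le _ _ mu (fun x => dot x theta)).
- by rewrite mule_ge0 ?lee_fin // sume_ge0 // => w _; exact: outer_measure_ge0.
- move=> t; apply: caratheodory_closed => //.
  apply: (@closed_comp _ _ (fun x : 'rV[R]_n => dot x theta) [set u | u <= t]).
    by move=> *; exact: dot_continuous.
  exact: closed_le.
- exists (n%:R * (`|N| * enorm theta)) => _ [x [[_ xN] _] <-].
  apply: dot_le_coord => // i; last exact: coord_le_enorm.
  by apply: le_trans (xN i) _; exact: ler_norm.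
move=> x [[/= Ax xN] xk].
(* The points of the cube below the level of x lie within its diameter n s and
   outside the half-space at x. *)
apply: (@le_trans _ _ (mu (eball x (n%:R * s) `\` halfspace x theta))).
  apply: le_outer_measure => y [[_ yk] /= yx]; split => /=.
    by apply: (grid_cell_diam _ [ffun=> 0]) => //; rewrite xk yk.
  rewrite /halfspace /cone /= mul0r dotBl subr_gt0.
  by apply/negP; rewrite -leNgt.
apply: le_trans (ltW Ax) _; rewrite lee_wpmul2l ?lee_fin //.
apply: outer_measure_finite_cover => y yx.
have [w yw] := grid_cell_neighbour _ _ _ s0 yx.
exists w; split; last by rewrite /= yw xk.
move=> i; have := le_trans (coord_le_enorm _ i) (le_trans yx s1).
rewrite !mxE => yx1; have := ler_normD (x ord0 i) (y ord0 i - x ord0 i).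
by rewrite addrC subrK => /le_trans; apply; rewrite lerD.
Qed.

(** The exponents 1 / (m + 1) are a countable family tending to 0, so that
the exceptional sets can be united. *)
Definition halfball_thick {R : realType} {n : nat} (mu : set 'rV[R]_n -> \bar R)
    (theta x : 'rV[R]_n) : Prop :=
  forall m : nat, exists k0, forall k, (k0 <= k)%N ->
    ((expR (- (k%:R / m.+1%:R)))%:E * mu (eball x (expR (- k%:R) / n%:R)%R) <=
     mu (eball x (expR (- k%:R)) `\` halfspace x theta))%E.

Lemma almost_all_halfball_thick {R : realType} {n : nat}
    (mu : {outer_measure set 'rV[R]_n -> \bar R}) (theta : 'rV[R]_n) :
  (0 < n)%N -> is_measure mu -> almost_all mu (halfball_thick mu theta).
Proof.
move=> n0 mu_meas; apply: almost_all_forall => m.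
suff H (N : nat) : mu ([set x | ~ exists k0, forall k, (k0 <= k)%N ->
    ((expR (- (k%:R / m.+1%:R)))%:E * mu (eball x (expR (- k%:R) / n%:R)%R) <=
     mu (eball x (expR (- k%:R)) `\` halfspace x theta))%E] `&`
    cube N%:R) = 0%E.
  apply: (@outer_measure_bigcup_null _ _ mu _ _ _ H) => x nx.
  exists (Num.truncn (enorm x)).+1 => //; split => // i.
  apply: le_trans (coord_le_enorm _ i) _; rewrite ltW //.
  by have /andP[] := truncn_itv (enorm_ge0 x).
pose q := expR (- m.+1%:R^-1) : R.
have q01 : 0 < q < 1.
  by rewrite expR_gt0 /= -expR0 ltr_expR oppr_lt0 invr_gt0.
have qk k : q ^+ k = expR (- (k%:R / m.+1%:R)).
  by rewrite -expRM_natl mulrN.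
have fin : mu (cube (N%:R + 1)) \is a fin_num.
  rewrite ge0_fin_numE ?outer_measure_ge0 //.
  by case: mu_meas => _ _; apply; exact: bounded_cube.
pose C := #|{ffun 'I_n -> 'I_3}|%:R * fine (mu (cube (N%:R + 1))).
have C0 : 0 <= C by rewrite mulr_ge0 // fine_ge0 // outer_measure_ge0.
pose A k := [set x | (mu (eball x (expR (- k%:R)) `\` halfspace x theta) <
   (q ^+ k)%:E * mu (eball x (expR (- k%:R) / n%:R)%R))%E] `&` cube N%:R.
have AC k : (mu (A k) <= (C * q ^+ k)%:E)%E.
  have n0' : n%:R != 0 :> R by rewrite pnatr_eq0 -lt0n.
  have s01 : 0 < (expR (- k%:R) / n%:R : R) <= 1.
    rewrite divr_gt0 ?expR_gt0 ?ltr0n //= ler_pdivrMr ?ltr0n // mul1r.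
    by rewrite (@le_trans _ _ 1) ?ler1n // -expR0 ler_expR oppr_le0.
  have := deficient_measure_le mu theta N%:R (expR (- k%:R) / n%:R) (q ^+ k)
    mu_meas s01.
  rewrite exprn_ge0 ?expR_ge0 // mulrC divfK // => /(_ isT).
  by rewrite -(fineK fin) -!EFinM [C * _]mulrC.
apply/eqP; rewrite eq_le outer_measure_ge0 andbT.
rewrite -(outer_measure_Borel_Cantelli mu A _ _ C0 q01 AC).
apply: le_outer_measure => x [/= nk xN] k0.
have /existsNP[k /not_implyP[kk0 /negP]] := fun h => nk (ex_intro _ k0 h).
by rewrite -ltNge => lt; exists k => //; split => //=; rewrite qk.
Qed.

(** From the radii e^-k to all radii: with e^-k <= K s <= e^(1-k), the half
ball of radius K s contains that of radius e^-k, while B(x, s) is contained in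
the ball of radius e^-k / n. This is why K = e n. *)
Lemma halfball_thick_transfer {R : realType} {n : nat}
    (mu : {outer_measure set 'rV[R]_n -> \bar R}) (theta x : 'rV[R]_n) :
  (0 < n)%N -> halfball_thick mu theta x ->
  forall eta : R, 0 < eta -> \forall s \near 0^'+,
      ((expR (- (eta * (1 - ln (expR 1 * n%:R * s)))))%:E * mu (eball x s) <=
       mu (eball x (expR 1 * n%:R * s)%R `\` halfspace x theta))%E.
Proof.
move=> n0 bal eta eta0.
have [m] := ltr_add_invr eta0; rewrite add0r => /ltW meta.
have [k0 Hk] := bal m.
have nR : 0 < n%:R :> R by rewrite ltr0n.
set K := expR 1 * n%:R; have K0 : 0 < K by rewrite mulr_gt0 ?expR_gt0.
apply/at_right0P; exists (expR (- k0%:R) / K).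
  by rewrite divr_gt0 ?expR_gt0.
move=> s /andP[s0]; rewrite ltr_pdivlMr // mulrC => sk.
have Ks0 : 0 < K * s by rewrite mulr_gt0.
set L := ln (K * s).
have LK : K * s = expR L by rewrite lnK.
have Lk : k0%:R < - L by rewrite ltrNr -ltr_expR -LK.
have /andP[t1 t2] : (Num.truncn (- L))%:R <= - L < (Num.truncn (- L)).+1%:R.
  apply: truncn_itv; exact: le_trans (ltW Lk).
(* The least k with e^-k < K s. *)
set k := (Num.truncn (- L)).+1 in t2.
have k1 : k%:R <= 1 - L by rewrite /k -addn1 natrD; lra.
have k0k : (k0 <= k)%N by rewrite -(ler_nat R) ltW // (lt_trans Lk).
apply: (@le_trans _ _ (mu (eball x (expR (- k%:R)) `\` halfspace x theta)));
  last first.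
  apply: le_outer_measure; apply: setSD; apply: eball_subset.
  by rewrite LK ler_expR; lra.
apply: le_trans (Hk k k0k); apply: lee_pmul.
- by rewrite lee_fin expR_ge0.
- exact: outer_measure_ge0.
- rewrite lee_fin ler_expR lerN2 mulrC.
  by apply: ler_pM => //; rewrite invr_ge0.
- apply: le_outer_measure; apply: eball_subset.
  rewrite ler_pdivlMr // -(@ler_pM2l _ (expR 1)) ?expR_gt0 //.
  by rewrite (mulrC s) mulrA LK -expRD ler_expR; lra.
Qed.

Lemma halfball_thick_log_ratio {R : realType} {n : nat}
    (mu : {outer_measure set 'rV[R]_n -> \bar R}) (theta x : 'rV[R]_n)
    (c c' : R) :
  (0 < n)%N -> halfball_thick mu theta x -> c < c' -> \forall s \near 0^'+,
    (log_ratio mu (eball x s) s <= c%:E)%E ->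
    (log_ratio mu (eball x (expR 1 * n%:R * s)%R `\` halfspace x theta)
       (expR 1 * n%:R * s)%R <= c'%:E)%E.
Proof.
move=> n0 bal; apply: (@log_ratio_transfer _ _ (fun r => mu (eball x r))
  (fun r => mu (eball x r `\` halfspace x theta))) => *.
- have : 1 <= expR 1 :> R by rewrite -expR0 ler_expR.
  have : 1 <= n%:R :> R by rewrite ler1n.
  nra.
- exact: outer_measure_ge0.
- exact: outer_measure_ge0.
- exact: halfball_thick_transfer.
Qed.

(** * Equality of the local dimensions *)

Lemma log_ratio_subset {R : realType} {n : nat}
    (mu : {outer_measure set 'rV[R]_n -> \bar R}) (A B : set 'rV[R]_n) (r : R) :
  0 < r < 1 -> A `<=` B -> (log_ratio mu B r <= log_ratio mu A r)%E.
Proof.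
move=> r01 AB; apply: log_ratio_monotone => //.
exact: le_outer_measure.
Qed.

Theorem corollary2p2 (R : realType) (n : nat) (n_ge1 : (1 <= n)%N)
    (mu : {outer_measure set 'rV[R]_n -> \bar R}) (mu_meas : is_measure mu) :
  (forall theta : 'rV[R]_n, esphere theta ->
    almost_all mu (fun x =>
      upper_local_dim mu x =
        limf_esup (fun r : R =>
          log_ratio mu (eball x r `\` halfspace x theta) r) 0^'+ /\
      lower_local_dim mu x =
        limf_einf (fun r : R =>
          log_ratio mu (eball x r `\` halfspace x theta) r) 0^'+)) /\
  (forall alpha : R, 0 < alpha -> alpha <= 1 ->
    almost_all mu (fun x =>
      upper_local_dim mu x =
        limf_esup (fun r : R =>
          ereal_sup [set log_ratio mu (eball x r `\` cone x theta alpha) r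
                    | theta in esphere]) 0^'+ /\
      lower_local_dim mu x =
        limf_einf (fun r : R =>
          ereal_sup [set log_ratio mu (eball x r `\` cone x theta alpha) r
                    | theta in esphere]) 0^'+)).
Proof.
have nR : 0 < n%:R :> R by rewrite ltr0n.
have K0 : 0 < expR 1 * n%:R :> R by rewrite mulr_gt0 ?expR_gt0.
split=> [theta _|alpha alpha0 _].
  apply: (@almost_all_mono _ _ _ (halfball_thick mu theta)); last first.
    exact: almost_all_halfball_thick.
  move=> x bal; apply: (limf_transfer _ _ _ K0) => [|c c' cc'].
    apply/at_right0P; exists 1 => // r r01.
    by apply: log_ratio_subset => //; exact: subDsetl.
  exact: halfball_thick_log_ratio.
have [W [net netP]] : exists (W : finType) (net : W -> 'rV[R]_n),
    forall theta, esphere theta -> exists w,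
      forall i, `|(theta - net w) ord0 i| <= alpha / n%:R.
  by apply: finite_net_esphere; rewrite divr_gt0.
apply: (@almost_all_mono _ _ _
  (fun x => forall w, halfball_thick mu (net w) x)); last first.
  by apply: almost_all_forall => w; exact: almost_all_halfball_thick.
move=> x bal; apply: (limf_transfer _ _ _ K0) => [|c c' cc'].
  apply/at_right0P; exists 1 => // r r01.
  (* As 0 < n, the sphere is not empty and the supremum is over some cone. *)
  pose e : 'rV[R]_n := delta_mx ord0 (Ordinal n_ge1).
  have eS : esphere e.
    rewrite /esphere /= /enorm /dot (bigD1 (Ordinal n_ge1)) //= big1 => [|i ni].
      by rewrite !mxE !eqxx mulr1 addr0 sqrtr1.
    by rewrite !mxE (negbTE ni) andbF mulr0.
  apply: le_ereal_sup_tmp.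
  exists (log_ratio mu (eball x r `\` cone x e alpha) r).
    by exists e.
  by apply: log_ratio_subset => //; exact: subDsetl.
have : \forall s \near 0^'+, forall w,
    (log_ratio mu (eball x s) s <= c%:E)%E ->
    (log_ratio mu (eball x (expR 1 * n%:R * s)%R `\` halfspace x (net w))
       (expR 1 * n%:R * s)%R <= c'%:E)%E.
  by apply: filter_forall => w; exact: halfball_thick_log_ratio.
move=> /at_right0P[e e0 He]; apply/at_right0P.
exists (Num.min e (expR 1 * n%:R)^-1); first by rewrite lt_min e0 invr_gt0.
move=> s /andP[s0]; rewrite lt_min => /andP[se sK] sc.
apply: ge_ereal_sup => _ [theta thS <-].
have [w netw] := netP _ thS.
apply: le_trans (He s _ w sc); last by rewrite s0.
apply: log_ratio_subset.
  by rewrite mulr_gt0 //= mulrC -ltr_pdivlMr // div1r.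
by apply: setDS; exact: cone_sub_halfspace.
Qed.
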